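(* Let $R$ be a finite local commutative ring which is not a field and satisfies $\mathrm{rad}(R)^2=\{0\}$, and let $K\le R^\times$. Then the cyclotomic scheme $\mathrm{Cyc}(K,R)$ is normal whenever $K$ is pure.
   Context: All rings have an identity. For a finite local commutative ring $R$, $\mathrm{rad}(R)$ is its unique maximal ideal. For a subgroup $K$ of $R^\times$, the cyclotomic scheme $\mathrm{Cyc}(K,R)$ is the pair $(R,\mathrm{Rel}(K,R))$, where $\mathrm{Rel}(K,R)$ is the set of binary relations $\{(x,y)\in R\times R:\ y-x\in rK\}$, $r\in R$. Its automorphism group $\mathrm{Aut}(\mathcal C)$ is the group of permutations $f$ of $R$ with $S^f=S$ for all $S\in\mathrm{Rel}(K,R)$. $\mathrm{A\Gamma L}_1(R)$ is the group of permutations $x\mapsto ax^\sigma+b$ with $a\in R^\times$, $b\in R$, $\sigma\in\mathrm{Aut}(R)$; the scheme is normal if $\mathrm{Aut}(\mathcal C)\le\mathrm{A\Gamma L}_1(R)$. A group $K\le R^\times$ is pure if the only ideal $I$ of $R$ with $1+I\subseteq K$ is $I=\{0\}$. *)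

(* Defs.v *)
From HB Require Import structures.
From mathcomp Require Import all_boot all_order all_algebra all_fingroup.
Set Implicit Arguments. Unset Strict Implicit. Unset Printing Implicit Defensive.
Import GRing.Theory.
Local Open Scope ring_scope.

Section Defs.
Variable R : finComUnitRingType.

Definition is_ideal (I : {set R}) : Prop :=
  0 \in I /\ (forall x y, x \in I -> y \in I -> x - y \in I) /\
  (forall r x, x \in I -> r * x \in I).

Definition is_maximal_ideal (M : {set R}) : Prop :=
  is_ideal M /\ M != [set: R] /\
  (forall J, is_ideal J -> M \subset J -> J = M \/ J = [set: R]).

(* M is the unique maximal ideal of R (so R is local and M = rad R) *)
Definition is_rad_local (M : {set R}) : Prop :=
  is_maximal_ideal M /\ (forall J, is_maximal_ideal J -> J = M).

Definition is_field_ring : Prop := forall x : R, x != 0 -> x \is a GRing.unit.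

Definition unit_set (K : {set {unit R}}) : {set R} := [set val u | u in K].

Definition cyc_rel (K : {set {unit R}}) (r : R) : {set R * R} :=
  [set p : R * R | p.2 - p.1 \in [set r * k | k in unit_set K]].

Definition cyc_aut (K : {set {unit R}}) (f : {perm R}) : Prop :=
  forall r : R,
    [set (f p.1, f p.2) | p in cyc_rel K r] = cyc_rel K r.

Definition ring_aut (s : R -> R) : Prop :=
  bijective s /\ {morph s : x y / x + y} /\ {morph s : x y / x * y} /\ s 1 = 1.

Definition in_AGammaL1 (f : R -> R) : Prop :=
  exists a b s, a \is a GRing.unit /\ ring_aut s /\ forall x, f x = a * s x + b.

Definition cyc_normal (K : {set {unit R}}) : Prop :=
  forall f : {perm R}, cyc_aut K f -> in_AGammaL1 f.

Definition pure (K : {set {unit R}}) : Prop :=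
  forall I : {set R}, is_ideal I ->
    (forall x, x \in I -> 1 + x \in unit_set K) -> I = [set 0].
End Defs.

(* Main.v *)
Require Import Defs.
From HB Require Import structures.
From mathcomp Require Import all_boot all_order all_algebra all_fingroup.
From mathcomp Require Import all_solvable ring.
Set Implicit Arguments. Unset Strict Implicit. Unset Printing Implicit Defensive.
Import GRing.Theory.
Local Open Scope ring_scope.

(* Let A = {a in M | 1 + a in K}, an additive subgroup of M containing no
   nonzero ideal, and let f be an automorphism of the scheme normalized by
   f 0 = 0 and f 1 = 1.  If two elements of one class r K (r a unit) are
   congruent mod M, they differ by an element of r A.  Applied to differences
   of values of f, this shows that the functions
     f (x + m) - f x  (m in M),       f (x m) - f x m  (m in M),
     f (x + y) - f x - f y,           (f (x y) - f x f y) / f y  (y a unit)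
   are, as functions of z = f x, functions g : R -> M whose difference quotients
   (g z - g w) / (z - w), z - w a unit, lie in A.  The key point is that such a
   g has the form g z = z a + c with a in A; this forces the four functions to
   be the ones they have to be for f to be a ring automorphism.
   To prove the key point, note that the functions in question form a finite
   p-group on which the translations x |-> x + t act as commuting operators of
   p-power order, so that it is enough to treat g with all differences
   g (x + t) - g x affine in x; by symmetry in x and t such a g is additive up
   to a constant.  If g is additive and c in R generates (R / M)^*, put
   S_c g x = c^-1 g (c x) and Y = S_c - 1.  Both Y and (c - 1)^-1 Y = S_(c-1) - S_c
   preserve the condition on g, and Y^(p^k) = S_(c^(p^k)) - 1 = Y for a suitable
   k > 0.  Hence every multiple of Y g satisfies the condition, and Y g = 0
   since A contains no nonzero ideal. *)

(** * Iterated differences of additive maps *)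

Section Differences.
Variables (V : zmodType) (s : V -> V).
Hypothesis sD : {morph s : x y / x + y}.
Let d x := s x - x.

Lemma morphD0 : s 0 = 0.
Proof. by apply: (addrI (s 0)); rewrite -sD !addr0. Qed.

Lemma morphDMn n : {morph s : x / x *+ n}.
Proof. by move=> x; elim: n => [|n IH]; rewrite ?morphD0 // !mulrS sD IH. Qed.

(** Binomial expansion of [s] = 1 + [d] among additive maps; the induction step is Pascal's rule. *)
Lemma iter_newton n x : iter n s x = \sum_(j < n.+1) iter j d x *+ 'C(n, j).
Proof.
elim: n => [|n IH]; first by rewrite big_ord1.
have sE y : s y = d y + y by rewrite subrK.
rewrite iterS IH (big_morph s sD morphD0).
under eq_bigr do rewrite morphDMn sE mulrnDl -iterS.
rewrite big_split /= [RHS]big_ord_recl [in RHS]big_ord_recr /=.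
rewrite [X in _ + X]big_ord_recl [X in X + _]big_ord_recr /= !bin0 !binn.
rewrite addrCA; congr (_ + _); rewrite addrAC; congr (_ + _).
by rewrite -big_split /=; apply: eq_bigr => i _; rewrite /bump /= add1n binS mulrnDr addrC.
Qed.

(** In Newton's formula the inner binomial coefficients are divisible by [p], and [p] kills every
    iterated difference of [x]. *)
Lemma iter_diff_prime p x : prime p -> x *+ p = 0 -> iter p d x = iter p s x - x.
Proof.
move=> p_pr px0.
have dMn n y : d (y *+ n) = d y *+ n by rewrite /d morphDMn mulrnBl.
have d0 : d 0 = 0 by rewrite /d morphD0 subr0.
have kill j : iter j d x *+ p = 0.
  by elim: j => // j IH; rewrite iterS -dMn IH.
rewrite iter_newton; case: p p_pr px0 kill => // p p_pr px0 kill.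
rewrite big_ord_recr big_ord_recl /= bin0 binn !mulr1n big1 ?addr0.
  by rewrite addrAC subrr add0r.
move=> i _; have /dvdnP[q ->] : (p.+1 %| 'C(p.+1, bump 0 i))%N.
  by apply: prime_dvd_bin => //; rewrite /bump /= add1n ltnS.
by rewrite mulnC mulrnA -iterS kill mul0rn.
Qed.

End Differences.

Lemma iter_diff_prime_pow (V : zmodType) (s : V -> V) p k (x : V) :
  {morph s : x y / x + y} -> prime p -> x *+ p = 0 ->
  iter (p ^ k) (fun y => s y - y) x = iter (p ^ k) s x - x.
Proof.
move=> sD p_pr px0.
suff iterE y : y *+ p = 0 ->
    iter (p ^ k) (fun y => s y - y) y = iter (p ^ k) s y - y by exact: iterE.
elim: k y {x px0} => [|k IH] x px0; first by [].
pose sk := iter (p ^ k) s.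
have skD : {morph sk : x y / x + y}.
  by rewrite /sk; elim: (p ^ k)%N => // n IHn u v; rewrite !iterS IHn sD.
have kill n : iter n (fun y => sk y - y) x *+ p = 0.
  by elim: n => // n IHn; rewrite iterS mulrnBl -morphDMn // IHn morphD0 // subr0.
have iterM (f : V -> V) n y : iter (p * n) f y = iter p (iter n f) y.
  elim: p {p_pr px0 kill IH sk skD} => // q IHq.
  by rewrite mulSn iterD IHq.
rewrite expnS iterM [in RHS]iterM.
(* By induction each block of [p ^ k] differences of [s] is a single difference of [sk], so only the
   exponent [p] remains. *)
transitivity (iter p (fun y => sk y - y) x); last exact: iter_diff_prime.
elim: {1 3}p => // n IHn; rewrite iterS IHn iterS; exact: IH.
Qed.

(** * Local rings whose maximal ideal [M] has square zero *)

Section LocalRing.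
Variables (R : finComUnitRingType) (M : {set R}).
Hypothesis inM : forall x, (x \in M) = (x \isn't a GRing.unit).
Hypothesis M_sub : forall x y, x \in M -> y \in M -> x - y \in M.
Hypothesis M_mul : forall (r x : R), x \in M -> r * x \in M.
Hypothesis M_sqr : forall x y, x \in M -> y \in M -> x * y = 0.
Variable m0 : R.
Hypothesis m0M : m0 \in M.
Hypothesis m0_neq0 : m0 != 0.

Lemma notinM x : (x \notin M) = (x \is a GRing.unit).
Proof. by rewrite inM negbK. Qed.

Lemma M_0 : 0 \in M. Proof. by rewrite -(subrr m0) M_sub. Qed.

Lemma M_opp x : x \in M -> - x \in M.
Proof. by move=> xM; rewrite -[- x]add0r M_sub ?M_0. Qed.

Lemma M_mulr r x : x \in M -> x * r \in M.
Proof. by rewrite mulrC; apply: M_mul. Qed.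

Lemma unitDM u m : u \is a GRing.unit -> m \in M -> u + m \is a GRing.unit.
Proof.
rewrite -!notinM => uNM mM; apply: contra uNM => umM.
by rewrite -(addrK m u) M_sub.
Qed.

Lemma unit1M m : m \in M -> 1 + m \is a GRing.unit.
Proof. by move=> mM; rewrite unitDM ?unitr1. Qed.

Lemma M_ann x m : m \in M -> m != 0 -> x * m = 0 -> x \in M.
Proof.
move=> mM m_neq0 xm0; rewrite inM; apply: contra m_neq0 => xU.
by rewrite -(mulKr xU m) xm0 mulr0.
Qed.

Lemma expr1M m n : m \in M -> (1 + m) ^+ n = 1 + m *+ n.
Proof.
move=> mM; elim: n => [|n IH]; first by rewrite addr0.
by rewrite exprS IH mulrDr mulr1 mulrnAr mulrDl mul1r (M_sqr mM mM) addr0 mulrS addrA.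
Qed.

(** The integer [#|R|] vanishes in [R]; dividing out prime factors that are units leads to a prime
    in [M], which kills [M] since products in [M] vanish. *)
Lemma residue_char : exists2 p, prime p & forall m, m \in M -> m *+ p = 0.
Proof.
have [p p_pr pM] : exists2 p, prime p & p%:R \in M.
  have cardM : #|R|%:R \in M.
    by rewrite -FinRing.Theory.zmodXgE -cardsT expg_cardG ?in_setT ?M_0.
  have : (0 < #|R|)%N by apply/card_gt0P; exists 0.
  elim/ltn_ind: #|R| cardM => n IH nM n_gt0.
  have [n_gt1|n_le1] := ltnP 1 n; last first.
    have n1 : n = 1%N by apply/eqP; rewrite eqn_leq n_le1.
    by move: nM; rewrite n1 inM unitr1.
  have [pM|pNM] := boolP ((pdiv n)%:R \in M).
    by exists (pdiv n); rewrite ?pdiv_prime.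
  have nE := divnK (pdiv_dvd n).
  apply: (IH (n %/ pdiv n)%N).
  - by rewrite ltn_Pdiv // prime_gt1 ?pdiv_prime.
  - apply: contraLR nM; rewrite -[in X in _ -> X]nE natrM !notinM unitrM => ->.
    by rewrite -notinM.
  - by rewrite divn_gt0 ?pdiv_gt0 // pdiv_leq.
by exists p => // m mM; rewrite -mulr_natr M_sqr.
Qed.

(* Multiplication by u on M has p-power order, so it is unipotent, as M has
   exponent p. *)
Lemma residue_unipotent p (u : R) k :
  prime p -> (forall m, m \in M -> m *+ p = 0) ->
  u ^+ (p ^ k) - 1 \in M -> u - 1 \in M.
Proof.
move=> p_pr pM0 uM.
have iterX n v x : iter n (fun y : R => v * y) x = v ^+ n * x.
  by elim: n => [|n IH]; rewrite ?mul1r // iterS IH exprS mulrA.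
have := @iter_diff_prime_pow R (fun y => u * y) p k m0 (mulrDr u) p_pr (pM0 _ m0M).
have -> : iter (p ^ k) (fun y => u * y - y) m0 = (u - 1) ^+ (p ^ k) * m0.
  by rewrite -iterX; apply: eq_iter => y; rewrite mulrBl mul1r.
rewrite iterX; have -> : u ^+ (p ^ k) * m0 - m0 = 0.
  by rewrite -(M_sqr uM m0M) mulrBl mul1r.
move/(M_ann m0M m0_neq0); rewrite !inM; apply: contra; exact: unitrX.
Qed.

(* z is a generator of the p'-part of the unit group. *)
Lemma residue_generator p :
  prime p -> (forall m, m \in M -> m *+ p = 0) ->
  exists z : R, [/\ z \is a GRing.unit, exists2 k, (0 < k)%N & z ^+ (p ^ k) = z,
    z - 1 \is a GRing.unit \/ z = 1
    & forall u, u \is a GRing.unit -> exists j, u - z ^+ j \in M].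
Proof.
move=> p_pr pM0.
pose G := [set: {unit R}]%G; pose T := 'O_p^'(G)%G.
have abG : abelian G.
  by apply/centsP => x _ y _; apply: val_inj; rewrite !FinRing.Theory.val_unitM mulrC.
have HallT pi : (pi.-Hall(G) 'O_pi(G))%g by rewrite nilpotent_pcore_Hall ?abelian_nil.
have T_elt t : t \in T -> p^'.-elt%g t by rewrite mem_Hall_pcore ?inE.
(* An element 1 + m of [T] with m in [M] has [p]-th power 1 + pm = 1, while its order is prime to
   [p]; so it is 1. *)
have T1 : {in T^#%g, forall t, val t - 1 \is a GRing.unit}.
  move=> t /setD1P[t1 tT]; rewrite -notinM; apply: contra t1 => tM.
  have tp : (t ^+ p)%g = 1%g.
    apply: val_inj.
    by rewrite FinRing.Theory.val_unitX /= -[val t](subrKC 1) expr1M // pM0 // addr0.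
  rewrite -order_eq1 -dvdn1 -(eqP (_ : coprime #[t]%g p)).
    by rewrite dvdn_gcd dvdnn order_dvdn tp eqxx.
  by rewrite coprime_sym prime_coprime // -p'natE //; apply: T_elt.
have [z defT] : exists z, T :=: <[z]>%g.
  apply/cyclicP; apply: (@div_ring_mul_group_cyclic {unit R} T R (fun t => val t) _ _ T1) => //.
  by rewrite (abelianS _ abG) ?subsetT.
have zT : z \in T by rewrite defT cycle_id.
exists (val z); split.
- exact: valP.
- have z_co : coprime p #[z]%g by rewrite prime_coprime // -p'natE //; apply: T_elt.
  (* Euler's theorem: [p] to this exponent is 1 modulo the order of [z]. *)
  exists (totient #[z]%g); first by rewrite totient_gt0 order_gt0.
  rewrite -FinRing.Theory.val_unitX; congr val; rewrite -[RHS]expg1.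
  by apply/eqP; rewrite eq_expg_mod_order Euler_exp_totient.
- have [->|z1] := eqVneq z 1%g; first by right.
  by left; apply: T1; rewrite !inE z1.
move=> u uU; pose v : {unit R} := Sub u uU.
have: (v.`_p^')%g \in T by rewrite mem_Hall_pcore ?inE ?p_elt_constt.
rewrite defT => /cycleP[j vE]; exists j.
have /p_natP[k ok] : p.-nat #[(v.`_p)%g]%g by apply: p_elt_constt.
(* The [p]-part of [u] is 1 modulo [M], so [u] is congruent to its [p']-part, a power of [z]. *)
have wM : val (v.`_p)%g - 1 \in M.
  apply: (@residue_unipotent p _ k) => //.
  by rewrite -FinRing.Theory.val_unitX -ok expg_order subrr M_0.
have -> : u = val (v.`_p)%g * val z ^+ j.
  by rewrite -FinRing.Theory.val_unitX -vE -FinRing.Theory.val_unitM consttC.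
by rewrite -{2}[val z ^+ j]mul1r -mulrBl M_mulr.
Qed.

(** * Functions into [M] with difference quotients in [A] *)

Variable A : {set R}.
Hypothesis A_M : forall a, a \in A -> a \in M.
Hypothesis A_0 : 0 \in A.
Hypothesis A_sub : forall a b, a \in A -> b \in A -> a - b \in A.
Hypothesis A_pure :
  forall z, z \in M -> (forall u, u \is a GRing.unit -> u * z \in A) -> z = 0.

Lemma divDM u m z : u \is a GRing.unit -> m \in M -> z \in M ->
  (u + m)^-1 * z = u^-1 * z.
Proof.
move=> uU mM zM; have umU := unitDM uU mM.
apply: (mulrI umU); rewrite mulVKr // mulrDl mulVKr // (M_sqr mM) ?addr0 //.
exact: M_mul.
Qed.

Definition slopes_in (g : {ffun R -> R}) : Prop :=
  (forall x, g x \in M) /\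
  (forall x y, x - y \is a GRing.unit -> (x - y)^-1 * (g x - g y) \in A).

Lemma slopes_inB g h : slopes_in g -> slopes_in h -> slopes_in (g - h).
Proof.
move=> [gM gA] [hM hA]; split=> [x|x y xyU]; rewrite !ffunE ?M_sub //.
have -> : g x + - h x - (g y + - h y) = (g x - g y) - (h x - h y) by ring.
by rewrite mulrBr A_sub ?gA ?hA.
Qed.

(** For a unit [u] and y = x - u^-1, the inverses of x - y and x + m - y both act on [M] as [u].
    Subtracting the two slopes puts [u * (g (x + m) - g x)] in [A], and purity applies. *)
Lemma slopes_in_periodic g x m : slopes_in g -> m \in M -> g (x + m) = g x.
Proof.
move=> [gM gA] mM; apply: subr0_eq; apply: A_pure => [|u uU]; first by rewrite M_sub.
have uVU : u^-1 \is a GRing.unit by rewrite unitrV.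
pose y := x - u^-1.
have xy : x - y = u^-1 by rewrite /y; ring.
have xmy : x + m - y = u^-1 + m by rewrite /y; ring.
have := gA (x + m) y; rewrite xmy divDM ?M_sub // unitDM // invrK => /(_ isT) A1.
have := gA x y; rewrite xy uVU invrK => /(_ isT) A2.
have -> : u * (g (x + m) - g x) = u * (g (x + m) - g y) - u * (g x - g y) by ring.
exact: A_sub.
Qed.

Let scale_arg c (g : {ffun R -> R}) : {ffun R -> R} := [ffun x => c^-1 * g (c * x)].
Let scale_val c (g : {ffun R -> R}) : {ffun R -> R} := [ffun x => c * g x].

Let additive_slopes (g : {ffun R -> R}) : Prop :=
  [/\ {morph g : x y / x + y}, forall x, g x \in M, forall x, x \in M -> g x = 0
    & forall u, u \is a GRing.unit -> u^-1 * g u \in A].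

Let additive_slopesB g h :
  additive_slopes g -> additive_slopes h -> additive_slopes (g - h).
Proof.
move=> [gD gM g0 gA] [hD hM h0 hA]; split=> [x y|x|x xM|u uU]; rewrite !ffunE.
- by rewrite gD hD; ring.
- by rewrite M_sub.
- by rewrite g0 ?h0 ?subr0.
- by rewrite mulrBr A_sub ?gA ?hA.
Qed.

Let additive_slopes_scale c g :
  c \is a GRing.unit -> additive_slopes g -> additive_slopes (scale_arg c g).
Proof.
move=> cU [gD gM g0 gA]; split=> [x y|x|x xM|u uU]; rewrite !ffunE.
- by rewrite mulrDr gD mulrDr.
- by rewrite M_mul.
- by rewrite g0 ?mulr0 ?M_mul.
- by rewrite mulrA -invrM // gA // unitrMl.
Qed.

Lemma additive_slopes_fixed c g :
    c \is a GRing.unit -> c - 1 \is a GRing.unit ->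
    (exists2 Q, (1 < Q)%N & iter Q (fun h => scale_arg c h - h) g = scale_arg c g - g) ->
    (forall u, u \is a GRing.unit -> exists j, u - c ^+ j \in M) ->
  additive_slopes g -> scale_arg c g = g.
Proof.
move=> cU c1U [Q Q_gt1 YQ] c_gen Pg.
pose Y h := scale_arg c h - h; pose b := (c - 1)^-1.
have PY h : additive_slopes h -> additive_slopes (Y h).
  by move=> Ph; apply: additive_slopesB => //; apply: additive_slopes_scale.
have PbY h : additive_slopes h -> additive_slopes (scale_val b (Y h)).
  move=> Ph.
  have -> : scale_val b (Y h) = scale_arg (c - 1) h - scale_arg c h.
    case: Ph => hD _ _ _; apply/ffunP => x; rewrite !ffunE -/b.
    have -> : h ((c - 1) * x) = h (c * x) - h x.
      by apply/eqP; rewrite eq_sym subr_eq -hD; apply/eqP; congr (h _); ring.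
    rewrite -[in RHS](mul1r (c^-1 * _)) -(mulVr c1U) -/b -mulrA -mulrBr; congr (b * _).
    by rewrite mulrA mulrBl divrr //; ring.
  by apply: additive_slopesB; apply: additive_slopes_scale.
have YZ l h : Y (scale_val l h) = scale_val l (Y h).
  by apply/ffunP => x; rewrite !ffunE; ring.
have iterYZ n l h : iter n Y (scale_val l h) = scale_val l (iter n Y h).
  by elim: n => // n IH; rewrite !iterS IH YZ.
have iterP n h : additive_slopes h -> additive_slopes (iter n Y h).
  by elim: n => // n IH Ph; rewrite iterS; apply/PY/IH.
(* L is an additive subgroup containing 1 and stable under b, hence under
   b^-1 = c - 1 and under c; so it contains every unit. *)
pose L l := additive_slopes (scale_val l (Y g)).
have L1 : L 1.
  rewrite /L; suff -> : scale_val 1 (Y g) = Y g by exact: PY.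
  by apply/ffunP => x; rewrite !ffunE mul1r.
have LB l1 l2 : L l1 -> L l2 -> L (l1 - l2).
  move=> H1 H2; rewrite /L.
  suff -> : scale_val (l1 - l2) (Y g) = scale_val l1 (Y g) - scale_val l2 (Y g).
    exact: additive_slopesB.
  by apply/ffunP => x; rewrite !ffunE; ring.
have L0 : L 0 by rewrite -(subrr 1); apply: LB.
have LD l1 l2 : L l1 -> L l2 -> L (l1 + l2).
  by move=> H1 H2; rewrite -[l2]opprK -[- l2]sub0r; apply/LB/LB.
have Lb l : L l -> L (b * l).
  move=> Ll; rewrite /L.
  (* On [g], [Y] agrees with its [Q]-th iterate. As [Q] is at least 2, this leaves an outermost [Y]
     to absorb the factor [b] through [PbY]. *)
  have -> : scale_val (b * l) (Y g) =
      scale_val b (Y (iter Q.-2 Y (scale_val l (Y g)))).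
    rewrite -iterS iterYZ -iterSr.
    have -> : Q.-2.+2 = Q by case: Q Q_gt1 {YQ} => [|[|]].
    by rewrite YQ; apply/ffunP => x; rewrite !ffunE mulrA.
  exact/PbY/iterP.
(* The unit group is finite, so the inverse of [b] is a power of [b]. *)
have [n bV] : exists n, c - 1 = b ^+ n.
  pose v : {unit R} := Sub (c - 1) c1U; exists #[v^-1]%g.-1.
  by rewrite -[b]/(val v^-1%g) -FinRing.Theory.val_unitX -invg_expg invgK.
have Lc1 l : L l -> L ((c - 1) * l).
  rewrite bV; elim: n {bV} l => [|n IH] l Ll; first by rewrite mul1r.
  by rewrite exprS -mulrA; apply/Lb/IH.
have Lc l : L l -> L (c * l).
  by move=> Ll; rewrite -[c](subrK 1) mulrDl mul1r; apply/LD => //; apply: Lc1.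
have LX j : L (c ^+ j).
  by elim: j => // j IH; rewrite exprS; apply: Lc.
have Yg_M x : Y g x \in M by case: (PY _ Pg).
(* [Y g] takes values in [M], so only the class of the multiplier modulo [M] matters. *)
have LU u : u \is a GRing.unit -> L u.
  move=> /c_gen[j ujM]; rewrite /L.
  suff -> : scale_val u (Y g) = scale_val (c ^+ j) (Y g) by exact: LX.
  apply/ffunP => x; rewrite ![scale_val _ _ x]ffunE.
  by apply/eqP; rewrite -subr_eq0 -mulrBl (M_sqr ujM (Yg_M x)).
apply: subr0_eq; apply/ffunP => x; rewrite [RHS]ffunE -/(Y g).
have [xM|xU] := boolP (x \in M); first by have [_ _ -> //] := PY _ Pg.
rewrite notinM in xU; have xVU : x^-1 \is a GRing.unit by rewrite unitrV.
apply: (mulrI xVU); rewrite mulr0.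
apply: A_pure => [|u uU]; first by rewrite M_mul.
have [_ _ _ /(_ x xU)] := LU u uU.
by rewrite [scale_val _ _ x]ffunE mulrCA.
Qed.

(** Once [g] commutes with multiplication by [z], it is linear on the powers of [z]; these represent
    all units modulo [M], where [g] vanishes. *)
Lemma additive_slopes_linear (g : {ffun R -> R}) :
  {morph g : x y / x + y} -> slopes_in g -> exists2 a, a \in A & forall x, g x = x * a.
Proof.
move=> gD g_sl.
have g0 : g 0 = 0 := morphD0 gD.
have [gM gA] := g_sl.
have gM0 x : x \in M -> g x = 0.
  by move=> xM; rewrite -[x]add0r slopes_in_periodic.
have Pg : additive_slopes g.
  by split=> // u uU; have := gA u 0; rewrite !subr0 g0 subr0; apply.
have [p p_pr pM0] := residue_char.
have [z [zU [k k_gt0 zk] z1 z_gen]] := residue_generator p_pr pM0.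
have gz x : g (z * x) = z * g x.
  (* The case [z] = 1 is that of a residue field with two elements. *)
  case: z1 => [z1U|->]; last by rewrite !mul1r.
  suff /ffunP/(_ x) : scale_arg z g = g.
    by rewrite ffunE => zg; rewrite -zg mulVKr.
  apply: additive_slopes_fixed => //; exists (p ^ k)%N.
    by rewrite -(exp1n k) ltn_exp2r // prime_gt1.
  rewrite iter_diff_prime_pow //; last first.
  - by apply/ffunP => y; rewrite ffunMnE [RHS]ffunE pM0.
  - by move=> h h'; apply/ffunP => y; rewrite !ffunE mulrDr.
  have iterE n : iter n (scale_arg z) g = scale_arg (z ^+ n) g.
    elim: n => [|n IH].
      by apply/ffunP => y; rewrite !ffunE expr0 invr1 !mul1r.
    rewrite iterS IH; apply/ffunP => y; rewrite !ffunE exprSr invrM ?unitrX //.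
    by rewrite !mulrA.
  by rewrite iterE zk.
have gX j : g (z ^+ j) = z ^+ j * g 1.
  by elim: j => [|j IH]; rewrite ?mul1r // exprS gz IH mulrA.
exists (g 1) => [|x].
  by have [_ _ _ /(_ 1 (unitr1 _))] := Pg; rewrite invr1 mul1r.
have [xM|] := boolP (x \in M); first by rewrite gM0 ?(M_sqr xM (gM 1)).
rewrite notinM => /z_gen[j xjM].
by rewrite -[x](subrKC (z ^+ j)) gD (gM0 _ xjM) gX mulrDl (M_sqr xjM (gM 1)).
Qed.

Let translate t (g : {ffun R -> R}) : {ffun R -> R} := [ffun x => g (x + t)].
Let diff t g := translate t g - g.
Let affine (g : {ffun R -> R}) := exists2 a, a \in A & forall x, g x = x * a + g 0.

Let slopes_in_diff t g : slopes_in g -> slopes_in (diff t g).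
Proof.
move=> g_sl; apply: slopes_inB => //; have [gM gA] := g_sl.
split=> [x|x y xyU]; rewrite !ffunE //.
have := gA (x + t) (y + t); have -> : x + t - (y + t) = x - y by ring.
exact.
Qed.

(** Let [h] be [g] minus its constant term. Exchanging 1 and [t] in h (1 + t) shows that the slope
    along [t] is [t * a1]; these all lie in [A], so purity gives [a1] = 0 and [h] is additive. *)
Lemma slopes_in_affine_diff g :
  slopes_in g -> (forall t, affine (diff t g)) -> affine g.
Proof.
move=> g_sl gD; pose h := [ffun x => g x - g 0].
have h0 : h 0 = 0 by rewrite ffunE subrr.
have hD t : exists2 a, a \in A & forall x, h (x + t) = h x + h t + x * a.
  have [a aA aE] := gD t; exists a => // x; have := aE x.
  rewrite !ffunE add0r => E.
  have -> : g (x + t) = g (x + t) + - g x + g x by rewrite subrK.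
  by rewrite E; ring.
have h_sl : slopes_in h.
  have [gM gA] := g_sl; split=> [x|x y xyU]; rewrite !ffunE ?M_sub //.
  have -> : g x - g 0 - (g y - g 0) = g x - g y by ring.
  exact: gA.
have [a1 a1A a1E] := hD 1.
have aE t a : (forall x, h (x + t) = h x + h t + x * a) -> a = t * a1.
  move=> /(_ 1); rewrite addrC a1E mul1r [h t + _]addrC => /addrI <-.
  by [].
have a1_0 : a1 = 0.
  apply: A_pure => [|t _]; first exact: A_M.
  by have [a aA /aE <-] := hD t.
have h_add : {morph h : x y / x + y}.
  move=> x t; have [a _ hE] := hD t.
  by rewrite hE (aE _ _ hE) a1_0 !mulr0 addr0.
have [a aA hE] := additive_slopes_linear h_add h_sl.
by exists a => // x; rewrite -hE ffunE subrK.
Qed.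

Lemma slopes_in_affine : forall g, slopes_in g -> affine g.
Proof.
have [p p_pr pM0] := residue_char.
have pM : p%:R \in M by apply: (M_ann m0M m0_neq0); rewrite mulr_natl pM0.
have affineD t g : affine g -> affine (diff t g).
  case=> a aA aE; exists 0 => // x.
  by rewrite !ffunE (aE (x + t)) (aE x) (aE (0 + t)); ring.
have diffC t s g : diff t (diff s g) = diff s (diff t g).
  apply/ffunP => x; rewrite !ffunE (_ : x + t + s = x + s + t); last by ring.
  by ring.
(* The [p]-th iterate is translation by pt minus the identity, and pt lies in [M], whose elements
   are periods of [g]. *)
have diff_nil t g : slopes_in g -> iter p (diff t) g = 0.
  move=> g_sl; have [gM _] := g_sl.
  rewrite -(expn1 p) iter_diff_prime_pow //; last first.
  - by apply/ffunP => y; rewrite ffunMnE [RHS]ffunE pM0.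
  - by move=> h h'; apply/ffunP => y; rewrite !ffunE.
  have iterE n : iter n (translate t) g = translate (t *+ n) g.
    elim: n => [|n IH]; first by apply/ffunP => y; rewrite !ffunE addr0.
    by rewrite iterS IH; apply/ffunP => y; rewrite !ffunE mulrS addrA.
  apply/ffunP => x; rewrite iterE !ffunE slopes_in_periodic ?subrr //.
  by rewrite expn1 -mulr_natr M_mul.
(* Iterated differences of h along t0 end at 0; go back up to h one difference
   at a time. *)
suff ind (s : seq R) h : slopes_in h -> (forall t, t \notin s -> affine (diff t h)) -> affine h.
  by move=> g g_sl; apply: (ind (enum R)) => // t; rewrite mem_enum inE.
elim: s h => [|t0 s IH] h h_sl hs; first by apply: slopes_in_affine_diff => // t; apply: hs.
have h_it j : slopes_in (iter j (diff t0) h).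
  by elim: j => // j IHj; rewrite iterS; apply: slopes_in_diff.
have it_diff j t : affine (diff t h) -> affine (diff t (iter j (diff t0) h)).
  elim: j => // j IHj ht; rewrite iterS diffC; exact/affineD/IHj.
suff /(_ p) : forall j, affine (iter (p - j) (diff t0) h) by rewrite subnn.
elim=> [|j IHj].
  by rewrite subn0 diff_nil //; exists 0 => // x; rewrite !ffunE mulr0 addr0.
have [jp|pj] := ltnP j p; last first.
  by move: IHj; rewrite subnS (eqP (pj : p - j == 0)%N).
(* Along [t0] the difference is the next iterate, affine by [IHj]; along other [t], differences
   commute and preserve affinity. *)
apply: IH => // t tNs.
have [->|t_t0] := eqVneq t t0; first by rewrite -iterS subnSK.
by apply/it_diff/hs; rewrite inE negb_or t_t0.
Qed.

(** * A normalized scheme automorphism is a ring automorphism *)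

Variable K : {set {unit R}}.
Hypothesis K_A : forall k k', k \in K -> k' \in K -> val k' - val k \in M ->
  (val k)^-1 * (val k' - val k) \in A.
Hypothesis K_mul : forall k k', k \in K -> k' \in K -> (k * k')%g \in K.
Variable f : R -> R.
Hypothesis f_K : forall x y, exists2 k, k \in K & f y - f x = (y - x) * val k.
Hypothesis f0 : f 0 = 0.
Hypothesis f1 : f 1 = 1.

Let f_unit x y : f x - f y \is a GRing.unit = (x - y \is a GRing.unit).
Proof. by have [k _ ->] := f_K y x; rewrite unitrMl ?(valP k). Qed.

Let f_inj : injective f.
Proof.
move=> x y fxy; have [k _] := f_K y x; rewrite fxy subrr => E.
by apply: subr0_eq; apply: (mulIr (valP k)); rewrite mul0r.
Qed.

Let f_M m : m \in M -> f m \in M.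
Proof. by rewrite !inM -{1}[m]subr0 -f_unit f0 subr0. Qed.

Let f_neq0 m : m != 0 -> f m != 0.
Proof. by apply: contraNneq => fm0; apply/eqP/f_inj; rewrite f0. Qed.

Let K_quotient r s s' : r \is a GRing.unit ->
    (exists2 k, k \in K & s = r * val k) -> (exists2 k, k \in K & s' = r * val k) ->
  s' - s \in M -> s^-1 * (s' - s) \in A.
Proof.
move=> rU [k kK ->] [k' k'K ->]; rewrite -mulrBr => kkM.
rewrite invrM ?(valP k) // -mulrA mulKr //; apply: K_A => //.
by rewrite -(mulKr rU (val k' - val k)) M_mul.
Qed.

(** Change of variable z = f x; [f] is a permutation preserving unit differences. *)
Let f_affine (g : R -> R) :
    (forall x, g x \in M) ->
    (forall x y, x - y \is a GRing.unit -> (f x - f y)^-1 * (g x - g y) \in A) ->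
  exists2 a, a \in A & forall x, g x = f x * a + g 0.
Proof.
move=> gM gA; pose fV := invF f_inj.
have fK : cancel f fV := invF_f f_inj; have fVK : cancel fV f := f_invF f_inj.
have [|a aA aE] := @slopes_in_affine [ffun z => g (fV z)].
  split=> [z|z w zwU]; rewrite !ffunE // -{1}[z]fVK -{1}[w]fVK; apply: gA.
  by rewrite -f_unit !fVK.
have fV0 : fV 0 = 0 by rewrite -{1}f0 fK.
by exists a => // x; have := aE (f x); rewrite !ffunE fV0 fK.
Qed.

(* The difference f (x + m) - f x is an affine function of f x with values in the
   line R * m, and it never vanishes; hence it is constant. *)
Let f_transl x m : m \in M -> f (x + m) = f x + f m.
Proof.
move=> mM; have [->|m_neq0] := eqVneq m 0; first by rewrite f0 !addr0.
pose e x := f (x + m) - f x.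
have eE y : exists2 k, k \in K & e y = m * val k.
  have [k kK] := f_K y (y + m); rewrite (_ : y + m - y = m); last by ring.
  by move=> E; exists k.
have eM y : e y \in M by have [k _ ->] := eE y; apply: M_mulr.
have [||a aA aE] := @f_affine e => //.
  move=> y z yzU.
  have -> : e y - e z = (f (y + m) - f (z + m)) - (f y - f z) by rewrite /e; ring.
  apply: (@K_quotient (y - z)) => //.
  - by have [k kK E] := f_K (z + m) (y + m); exists k; rewrite // E; ring.
  - have -> : f (y + m) - f (z + m) - (f y - f z) = e y - e z by rewrite /e; ring.
    exact: M_sub.
have [k0 _ k0E] := eE 0; have [k1 _ k1E] := eE 1.
have aE' : a = m * (val k1 - val k0).
  by rewrite mulrBr -k1E -k0E aE f1; ring.
have e0E : e 0 = f m by rewrite /e add0r f0 subr0.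
suff a0 : a = 0 by have := aE x; rewrite a0 mulr0 add0r e0E => <-; rewrite /e; ring.
have [kM|] := boolP (val k1 - val k0 \in M); first by rewrite aE' M_sqr.
(* [y] is the zero of the affine expression for [e], whereas [e y] is [m] times a unit. *)
rewrite notinM => dU; pose y := invF f_inj (- val k0 / (val k1 - val k0)).
have [k _ kE] := eE y; case/negP: m_neq0.
rewrite -(mulIr_eq0 m (mulIr (valP k))) -kE aE f_invF aE' k0E mulrCA divrK //.
by rewrite mulrN addNr.
Qed.

Let f_semilinear x m : m \in M -> f (x * m) = f x * f m.
Proof.
move=> mM.
have [||a aA] := @f_affine (fun x => f (x * m) - f x * m).
- by move=> y; rewrite M_sub ?f_M ?M_mul.
- move=> y z yzU.
  have [k kK kE] := f_K z y.
  (* This point differs from [z] by [(y - z) * (1 + m)], and [f_transl] computes [f] there;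
     comparing [k'] with [k] yields the slope. *)
  have [k' k'K k'E] := f_K z (y + (y - z) * m).
  have rmM : (y - z) * m \in M by apply: M_mul.
  have fyM : f (y * m) = f (z * m) + f ((y - z) * m).
    by rewrite -f_transl //; congr f; ring.
  rewrite f_transl // in k'E.
  have mU := unit1M mM.
  pose s := (y - z) * (1 + m) * val k; pose s' := (y - z) * (1 + m) * val k'.
  have s'E : s' = f y + f ((y - z) * m) - f z by rewrite k'E /s'; ring.
  have ssE : s' - s = f (y * m) - f y * m - (f (z * m) - f z * m).
    rewrite s'E /s mulrDr mulr1 mulrDl -kE mulrAC -kE fyM; ring.
  have ssM : s' - s \in M by rewrite ssE !M_sub ?f_M ?M_mul.
  have := @K_quotient ((y - z) * (1 + m)) s s'.
  rewrite unitrMl // yzU => /(_ isT) H.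
  have {H} := H (ex_intro2 _ _ k kK erefl) (ex_intro2 _ _ k' k'K erefl) ssM.
  have sE : s = (f y - f z) + (f y - f z) * m by rewrite kE /s; ring.
  by rewrite {1}sE divDM ?f_unit ?M_mul // ssE.
rewrite mul0r f0 mul0r subrr => aE.
have := aE 1; rewrite f1 mul1r mul1r !addr0 => fm.
by have := aE x; rewrite addr0 -{1}fm mulrBr => /addIr.
Qed.

Let f_congr x y : (f x - y) * f m0 = 0 -> f x - y \in M.
Proof. by move/M_ann; apply; rewrite ?f_M ?f_neq0. Qed.

Let f_additive : {morph f : x y / x + y}.
Proof.
(* Modulo [M], additivity can be tested after multiplication by the nonzero element [f m0] of [M],
   where semilinearity reduces it to [f_transl]. *)
have defM x y : f (x + y) - f x - f y \in M.
  rewrite -addrA -opprD; apply: f_congr.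
  by rewrite mulrBl mulrDl -!f_semilinear // -f_transl ?M_mul // -mulrDl subrr.
have lin y : exists2 a, a \in A & forall x, f (x + y) - f x - f y = f x * a.
  have [||a aA aE] := @f_affine (fun x => f (x + y) - f x - f y) => //.
    move=> x z xzU.
    have dE : f (x + y) - f x - f y - (f (z + y) - f z - f y) =
      (f (x + y) - f (z + y)) - (f x - f z) by ring.
    rewrite dE; apply: (@K_quotient (x - z)) => //.
    - by have [k kK E] := f_K (z + y) (x + y); exists k; rewrite // E; ring.
    - by rewrite -dE M_sub.
  by exists a => // x; rewrite aE add0r f0 subr0 subrr addr0.
have [a1 a1A a1E] := lin 1.
(* Symmetry in 1 and [y] again; as [f] is surjective, every multiple of [a1] is a slope and lies in
   [A]. *)
have aE y a : (forall x, f (x + y) - f x - f y = f x * a) -> a = f y * a1.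
  by move=> /(_ 1); rewrite f1 mul1r -a1E f1 [y + 1]addrC => <-; ring.
have a1_0 : a1 = 0.
  apply: A_pure => [|u _]; first exact: A_M.
  have [a aA /aE] := lin (invF f_inj u); rewrite f_invF => <-; exact: aA.
move=> x y; have [a aA aH] := lin y.
have := aH x; rewrite (aE _ _ aH) a1_0 !mulr0 => /subr0_eq <-; ring.
Qed.

(** For a unit [y], the defect divided by [f y] is affine in [f z] and vanishes at 0 and 1, hence
    everywhere. Factors in [M] are covered by semilinearity. *)
Let f_multiplicative : {morph f : x y / x * y}.
Proof.
have unit_case x y : y \is a GRing.unit -> f (x * y) = f x * f y.
  move=> yU; have fyU : f y \is a GRing.unit by rewrite -[f y]subr0 -f0 f_unit subr0.
  have defM z : f (z * y) - f z * f y \in M.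
    apply: f_congr.
    by rewrite mulrBl -!mulrA -!f_semilinear ?M_mul // mulrA subrr.
  have [||a aA aE] := @f_affine (fun z => (f y)^-1 * (f (z * y) - f z * f y)).
  - by move=> z; rewrite M_mul.
  - move=> z w zwU.
    pose s := (f z - f w) * f y; pose s' := f (z * y) - f (w * y).
    have dE : s' - s = f (z * y) - f z * f y - (f (w * y) - f w * f y).
      by rewrite /s /s'; ring.
    rewrite -mulrBr -dE.
    have -> : (f z - f w)^-1 * ((f y)^-1 * (s' - s)) = s^-1 * (s' - s).
      by rewrite mulrA /s [_ * f y]mulrC invrM ?f_unit.
    have [k kK kE] := f_K w z; have [k' k'K k'E] := f_K 0 y.
    have [k'' k''K k''E] := f_K (w * y) (z * y).
    apply: (@K_quotient ((z - w) * y)).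
    - by rewrite unitrMl.
    - exists (k * k')%g; first exact: K_mul.
      rewrite FinRing.Theory.val_unitM /s kE -[f y]subr0 -f0 k'E subr0; ring.
    - by exists k''; rewrite // /s' k''E -mulrBl.
    - by rewrite dE M_sub.
  have g0 : (f y)^-1 * (f (0 * y) - f 0 * f y) = 0.
    by rewrite mul0r f0 mul0r subrr mulr0.
  have := aE 1; rewrite g0 mul1r f1 !mul1r subrr mulr0 addr0 => a0.
  have := aE x; rewrite g0 -a0 mulr0 addr0 => E.
  by apply: subr0_eq; rewrite -(mulVKr fyU (_ - _)) E mulr0.
move=> x y; have [yM|] := boolP (y \in M); first exact: f_semilinear.
by rewrite notinM; apply: unit_case.
Qed.

Lemma difference_quotients_ring_aut : ring_aut f.
Proof. by split; [exact: injF_bij | split]. Qed.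

End LocalRing.

Lemma is_rad_localE (R : finComUnitRingType) (M : {set R}) :
  is_rad_local M -> forall x, (x \in M) = (x \isn't a GRing.unit).
Proof.
move=> [[[M_0 [M_sub M_mul]] [M_neqT M_max]] M_uniq] x; apply/idP/idP => [xM|xNU].
  apply: contra M_neqT => xU; apply/eqP/setP => y.
  by rewrite inE -(divrK xU y) M_mul.
pose idealb (J : {set R}) := [&& 0 \in J, [forall a in J, forall b in J, a - b \in J]
  & [forall r : R, forall a in J, r * a \in J]].
have idealP J : reflect (is_ideal J) (idealb J).
  apply: (iffP and3P) => [[J0 JB JM]|[J0 [JB JM]]]; split => //.
  - split=> [a b aJ bJ|r a aJ]; first by have /'forall_in_forall_inP := JB; apply.
    by have /forallP/(_ r)/forall_inP := JM; apply.
  - by apply/forall_inP => a aJ; apply/forall_inP => b; apply: JB.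
  - by apply/forallP => r; apply/forall_inP => a; apply: JM.
pose proper J := idealb J && (1 \notin J).
(* The principal ideal of a non-unit is proper, so it lies in a maximal ideal, which is [M] by
   uniqueness. *)
pose I : {set R} := [set r * x | r in [set: R]].
have I_proper : proper I.
  apply/andP; split.
    apply/idealP; split; first by apply/imsetP; exists 0; rewrite ?inE ?mul0r.
    split=> [a b|r a] /imsetP[s _ ->]; last first.
      by apply/imsetP; exists (r * s); rewrite ?inE ?mulrA.
    by case/imsetP => t _ ->; apply/imsetP; exists (s - t); rewrite ?inE ?mulrBl.
  apply: contra xNU => /imsetP[r _ rx]; apply/unitrPr.
  by exists r; rewrite mulrC -rx.
have [J /maxsetP[/andP[/idealP J_ideal J1] J_max] IJ] := maxset_exists I_proper.
have <- : J = M.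
  apply: M_uniq; split => //; split.
    by apply: contra J1 => /eqP ->; rewrite inE.
  move=> L L_ideal JL; have [L1|L1] := boolP (1 \in L).
    right; apply/setP => y; rewrite inE; have [_ [_ LM]] := L_ideal.
    by rewrite -[y]mulr1 LM.
  by left; apply: J_max => //; apply/andP; split => //; apply/idealP.
by apply: (subsetP IJ); apply/imsetP; exists 1; rewrite ?inE ?mul1r.
Qed.

Theorem theorem1p9 (R : finComUnitRingType) (M : {set R}) (K : {group {unit R}}) :
  is_rad_local M ->
  ~ is_field_ring R ->
  (forall x y, x \in M -> y \in M -> x * y = 0) ->
  pure K ->
  cyc_normal K.
Proof.
move=> M_rad notF M_sqr K_pure f f_aut.
have [[[M_0 [M_sub M_mul]] [M_neqT _]] _] := M_rad.
have inM := is_rad_localE M_rad.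
have [m0 m0M m0_neq0] : exists2 m, m \in M & m != 0.
  have [/exists_inP //|/exists_inPn M0] := boolP [exists x in M, x != 0].
  case: notF => x x_neq0.
  by rewrite -[_ \is a _]negbK -inM; apply: contra x_neq0 => /M0; rewrite negbK.
have unit_setP k : k \in K -> val k \in unit_set K by move=> kK; apply: imset_f.
pose A : {set R} := [set a in M | 1 + a \in unit_set K].
have A_M a : a \in A -> a \in M by rewrite inE => /andP[].
have A_0 : 0 \in A by rewrite inE M_0 addr0 (unit_setP 1%g) ?group1.
have A_sub a b : a \in A -> b \in A -> a - b \in A.
  rewrite !inE => /andP[aM /imsetP[k kK ka]] /andP[bM /imsetP[l lK lb]].
  (* Since [M] has square zero, 1 + (a - b) is the quotient of 1 + a by 1 + b. *)
  rewrite M_sub //=; suff -> : 1 + (a - b) = val (k * l^-1)%g.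
    by rewrite unit_setP ?groupM ?groupV.
  apply: (mulIr (valP l)); rewrite -FinRing.Theory.val_unitM mulgKV.
  rewrite -ka -lb; have -> : (1 + (a - b)) * (1 + b) = 1 + a + (a - b) * b by ring.
  by rewrite (M_sqr _ b) ?M_sub ?addr0.
have A_pure z : z \in M -> (forall u, u \is a GRing.unit -> u * z \in A) -> z = 0.
  move=> zM zA; pose I : {set R} := [set r * z | r in [set: R]].
  (* Multiples of [z] by elements of [M] are 0, the others are in [A] by assumption; so purity of
     [K] applies to the ideal generated by [z]. *)
  have I_A x : x \in I -> x \in A.
    case/imsetP => r _ ->; have [rM|] := boolP (r \in M); first by rewrite M_sqr.
    by rewrite inM negbK => /zA.
  have I0 : I = [set 0].
    apply: K_pure => [|x /I_A]; last by rewrite inE => /andP[].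
    split; first by apply/imsetP; exists 0; rewrite ?inE ?mul0r.
    split=> [x y|r x] /imsetP[s _ ->]; last first.
      by apply/imsetP; exists (r * s); rewrite ?inE ?mulrA.
    by case/imsetP => t _ ->; apply/imsetP; exists (s - t); rewrite ?inE ?mulrBl.
  by apply/set1P; rewrite -I0; apply/imsetP; exists 1; rewrite ?inE ?mul1r.
have K_A (k k' : {unit R}) : k \in K -> k' \in K -> val k' - val k \in M ->
    (val k)^-1 * (val k' - val k) \in A.
  move=> kK k'K kkM; rewrite inE M_mul //= mulrBr mulVr ?(valP k) //.
  rewrite addrC subrK (_ : _ * _ = val (k^-1 * k')%g) ?unit_setP ?groupM ?groupV //.
have f_K x y : exists2 k, k \in K & f y - f x = (y - x) * val k.
  have: (x, y) \in cyc_rel K (y - x).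
    rewrite inE /=; apply/imsetP; exists 1; rewrite ?mulr1 //.
    by apply: (unit_setP 1%g); apply: group1.
  move/(imset_f (fun p : R * R => (f p.1, f p.2))); rewrite f_aut inE /=.
  by case/imsetP => _ /imsetP[k kK ->] ->; exists k.
have [k1 k1K] := f_K 0 1; rewrite subr0 mul1r => k1E.
have k1U : val k1 \is a GRing.unit := valP k1.
(* Normalization of [f] to fix 0 and 1; dividing by [k1] keeps the quotients in [K]. *)
pose s x := (val k1)^-1 * (f x - f 0).
exists (val k1), (f 0), s; split => //; split; last first.
  by move=> x; rewrite mulVKr // subrK.
apply: (@difference_quotients_ring_aut R M inM M_sub M_mul M_sqr m0 m0M m0_neq0
          A A_M A_0 A_sub A_pure K K_A) => [k k' kK k'K|x y||].
- by rewrite groupM.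
- have [k kK kE] := f_K x y; exists (k1^-1 * k)%g; first by rewrite groupM ?groupV.
  rewrite FinRing.Theory.val_unitM FinRing.Theory.val_unitV /s.
  by rewrite mulrCA -kE; ring.
- by rewrite /s subrr mulr0.
- by rewrite /s k1E mulVr.
Qed.
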